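(* Let $k\ge 0$ be an integer and let $p$ be a permutation pattern of length $\ell>k$. Let $q$ be a consecutive subpattern of $p$ of length $\ell-k$ chosen so that its Stanley--Wilf limit $K_q$ is as large as possible. Then \[K_q^{\,n+o(n)}\le s_n^k(p)\le (k+1)^n K_q^{\,n+o(n)}\qquad (n\to\infty).\]
   Context: For permutations $p\in S_\ell$ and $q\in S_m$, $q$ is a consecutive subpattern of $p$ if for some $i\ge 0$ the entries $p_{i+1},\dots,p_{i+m}$ are order-isomorphic to $q$. For a pattern $q$, $s_n^0(q)$ is the number of permutations of $[n]$ avoiding $q$ (classically), and the Stanley--Wilf limit of $q$ is $K_q=\lim_{n\to\infty}\sqrt[n]{s_n^0(q)}$, which exists and is finite (Marcus--Tardos). $s_n^k(p)$ is the number of partial permutations of length $n$ with $k$ holes avoiding $p$: such a partial permutation is a sequence $\pi_1\cdots\pi_n$ in which each of $1,\dots,n-k$ appears once and the other $k$ entries are a hole symbol $\diamond$; a permutation $\sigma$ of $[n]$ is an extension of $\pi$ if the standardization (order-preserving relabeling by $1,2,\dots$) of $\sigma$ restricted to the non-hole positions of $\pi$ equals $\pi$ restricted to those positions; $\pi$ avoids $p$ if every extension avoids $p$. *)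

(* Defs.v *)
From mathcomp Require Import all_boot all_order all_algebra all_fingroup.
From mathcomp Require Import all_classical all_reals all_analysis.

Set Implicit Arguments.
Unset Strict Implicit.
Unset Printing Implicit Defensive.

Import Order.TTheory GRing.Theory Num.Theory.
Import numFieldNormedType.Exports.

(* A permutation of [n] is an element of 'S_n: positions and values are both
   numbered from 0, which is immaterial since only their order is used. *)

Section Patterns.
Local Open Scope nat_scope.

Definition contains (n l : nat) (s : 'S_n) (p : 'S_l) : bool :=
  [exists f : {ffun 'I_l -> 'I_n},
     [forall a : 'I_l, forall b : 'I_l, (a < b) ==> (f a < f b)] &&
     [forall a : 'I_l, forall b : 'I_l, (s (f a) < s (f b)) == (p a < p b)]].

Definition consecutive_subpattern (m l : nat) (q : 'S_m) (p : 'S_l) : Prop :=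
  exists (i : nat) (f : 'I_m -> 'I_l),
    (forall a, f a = i + a :> nat) /\
    (forall a b, (p (f a) < p (f b)) = (q a < q b)).

Definition num_avoiding (l : nat) (q : 'S_l) (n : nat) : nat :=
  #|[set s : 'S_n | ~~ contains s q]|.

(* [None] is the hole symbol. If n < k, then n - k = 0 forces all n entries to
   be holes, so that no such word has k holes. *)
Definition is_partial_perm (n k : nat) (w : {ffun 'I_n -> option 'I_(n - k)})
    : bool :=
  [forall v : 'I_(n - k), #|[set i | w i == Some v]| == 1] &&
  (#|[set i | w i == None]| == k).

(* The entry at position i in the standardization of the restriction of s to
   the positions in D, for i in D. *)
Definition standardization (n : nat) (D : {set 'I_n}) (s : 'S_n) (i : 'I_n)
    : nat :=
  #|[set j in D | s j < s i]|.

Definition nonholes (n k : nat) (w : {ffun 'I_n -> option 'I_(n - k)})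
    : {set 'I_n} :=
  [set i | w i != None].

Definition is_extension (n k : nat) (w : {ffun 'I_n -> option 'I_(n - k)})
    (s : 'S_n) : bool :=
  [forall i : 'I_n, forall v : 'I_(n - k), (w i == Some v) ==>
     (standardization (nonholes w) s i == v)].

Definition partial_avoids (n k l : nat)
    (w : {ffun 'I_n -> option 'I_(n - k)}) (p : 'S_l) : bool :=
  [forall s : 'S_n, is_extension w s ==> ~~ contains s p].

Definition num_partial_avoiding (l : nat) (p : 'S_l) (k n : nat) : nat :=
  #|[set w : {ffun 'I_n -> option 'I_(n - k)} |
      is_partial_perm w && partial_avoids w p]|.

End Patterns.

Section StanleyWilf.
Local Open Scope ring_scope.
Local Open Scope classical_set_scope.

(* The value at n = 0 of the sequence of n-th roots is irrelevant. *)
Definition stanley_wilf_limit (R : realType) (l : nat) (q : 'S_l) : R :=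
  limn (fun n : nat => (num_avoiding q n)%:R `^ (n%:R^-1) : R).

End StanleyWilf.

(* Main.v *)
(* Let m = l - k and let q_j be the pattern of the entries of p at positions
   j, ..., j + m - 1, for 0 <= j <= k.

   Lower bound: if q = q_i and s avoids q, put i holes before s and k - i holes
   after it. In an occurrence of p in an extension, the entries of p at
   positions i, ..., i + m - 1 cannot use holes, so they give an occurrence of
   q in s. Hence s_{n-k}^0(q) <= s_n^k(p).

   Upper bound: the k holes cut a partial permutation into k + 1 blocks. If
   block j contains q_j, the holes can be filled so as to complete this to an
   occurrence of p. A partial permutation that avoids p is thus determined by
   the distribution of the n - k values among the blocks and by an arrangement
   of each block j avoiding q_j. Since s_n^0(q_j) <= K_q^n for all n, this gives
   s_n^k(p) <= ((k + 1) K_q)^(n-k).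

   The inequality s_n^0(q) <= K_q^n and the existence of the limit follow from
   supermultiplicativity (Arratia) and Fekete's lemma, given the exponential
   bound of Marcus-Tardos, for which we use blocks of side t = (m + 1)^2. *)

Require Import Defs.
From mathcomp Require Import all_boot all_order all_algebra all_fingroup.
From mathcomp Require Import all_classical all_reals all_analysis.
From mathcomp Require Import zify ring lra.
Import Order.TTheory GRing.Theory Num.Theory.
Import numFieldNormedType.Exports.

Section Combinatorics.
Import mathcomp.boot.ssrnat mathcomp.boot.fintype mathcomp.boot.finset.
Local Open Scope nat_scope.
Set Implicit Arguments.
Unset Strict Implicit.

(** * Increasing maps, ranks and standardization *)

Definition increasing m n (f : 'I_m -> 'I_n) : Prop :=
  forall a b : 'I_m, a < b -> f a < f b.

Lemma increasing_ltn m n (f : 'I_m -> 'I_n) (a b : 'I_m) :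
  increasing f -> (f a < f b) = (a < b).
Proof.
move=> finc; have [/finc //|ba] := ltnP a b; apply/negbTE; rewrite -leqNgt.
by move: ba; rewrite leq_eqVlt => /predU1P[/val_inj->//|/finc/ltnW].
Qed.

Lemma increasing_inj m n (f : 'I_m -> 'I_n) : increasing f -> injective f.
Proof.
move=> fi a b fab; have := increasing_ltn a b fi; have := increasing_ltn b a fi.
by rewrite fab ltnn => ab ba; apply: val_inj => /=; lia.
Qed.

Definition rank (T : finType) (D : {set T}) (u : T -> nat) (i : T) : nat :=
  #|[set j in D | u j < u i]|.

Lemma ltn_rank (T : finType) (D : {set T}) (u : T -> nat) (i j : T) :
  i \in D -> (rank D u i < rank D u j) = (u i < u j).
Proof.
move=> iD; have [ij|ji] := ltnP (u i) (u j).
  apply: proper_card; apply/properP; split.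
    by apply/subsetP => x; rewrite !inE => /andP[-> /ltn_trans]; exact.
  by exists i; rewrite !inE ?ltnn ?andbF// iD.
apply/negbTE; rewrite -leqNgt; apply: subset_leq_card; apply/subsetP => x.
by rewrite !inE => /andP[->] /leq_trans; exact.
Qed.

Lemma rank_ltn_card (T : finType) (D : {set T}) (u : T -> nat) (i : T) :
  i \in D -> rank D u i < #|D|.
Proof.
move=> iD; apply: proper_card; apply/properP; split.
  by apply/subsetP => x; rewrite !inE => /andP[].
by exists i; rewrite // !inE ltnn andbF.
Qed.

Lemma rank_inj (T : finType) (D : {set T}) (u : T -> nat) :
  {in D &, injective u} -> {in D &, injective (rank D u)}.
Proof.
move=> uinj i j iD jD eq_ij; apply: uinj => //.
by case: (ltngtP (u i) (u j)) => //;
  rewrite -(ltn_rank u _ iD, ltn_rank u _ jD) eq_ij ltnn.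
Qed.

(** By [rank_inj] the ranks of the elements of [D] are [#|D|] distinct numbers below [#|D|], so none
    of these is missed. *)
Lemma rank_surj (T : finType) (D : {set T}) (u : T -> nat) (b : nat) :
  {in D &, injective u} -> b < #|D| -> exists2 i, i \in D & rank D u i = b.
Proof.
move=> uinj bD.
(* Outside [D] the rank may equal [#|D|]; the default value taken there is harmless. *)
pose r i : 'I_#|D| := insubd (Ordinal bD) (rank D u i).
have rE i : i \in D -> r i = rank D u i :> nat.
  by move=> iD; rewrite val_insubd rank_ltn_card.
have : r @: D = [set: 'I_#|D|].
  apply/eqP; rewrite eqEcard subsetT cardsT card_ord card_in_imset ?leqnn//.
  move=> i j iD jD /(congr1 val) /=; rewrite !rE//.
  exact: rank_inj.
move=> /setP/(_ (Ordinal bD)); rewrite inE => /imsetP[i iD ib].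
by exists i; rewrite // -rE// -ib.
Qed.

Lemma ex_increasing n (A : {set 'I_n}) m : m <= #|A| ->
  exists2 f : 'I_m -> 'I_n, increasing f & forall a, f a \in A.
Proof.
move=> mA.
have /fin_all_exists[f fP] : forall a : 'I_m, exists i,
    i \in A /\ rank A val i = a.
  move=> a; have [||i iA ia] := @rank_surj _ A val a.
  - by move=> ? ? _ _; exact: val_inj.
  - exact: leq_trans mA.
  - by exists i.
exists f => [a b ab|a]; last by case: (fP a).
have [fa ra] := fP a; have [_ rb] := fP b.
by rewrite -(@ltn_rank _ A val)// ra rb.
Qed.

Lemma ex_std m (u : 'I_m -> nat) : injective u ->
  exists s : 'S_m, forall a b, (s a < s b) = (u a < u b).
Proof.
move=> uinj.
have rlt a : rank [set: 'I_m] u a < m.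
  by have := @rank_ltn_card _ [set: 'I_m] u a; rewrite cardsT card_ord inE; exact.
have rinj : injective (fun a => Ordinal (rlt a)).
  by move=> a b /(congr1 val) /rank_inj; apply; rewrite ?inE//; exact: in2W.
by exists (perm rinj) => a b; rewrite !permE /= ltn_rank.
Qed.

(** For injective [u] the pick succeeds by [ex_std], so the default is never taken. *)
Definition std m (u : 'I_m -> nat) : 'S_m :=
  odflt 1%g [pick s : 'S_m | [forall a, forall b, (s a < s b) == (u a < u b)]].

Lemma ltn_std m (u : 'I_m -> nat) (a b : 'I_m) :
  injective u -> (std u a < std u b) = (u a < u b).
Proof.
move=> uinj; rewrite /std; case: pickP => [s /forallP/(_ a)/forallP/(_ b)/eqP//|].
have [s sP] := ex_std uinj => /(_ s) /negP[].
by apply/forallP => x; apply/forallP => y; apply/eqP.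
Qed.

Lemma containsP n l (s : 'S_n) (p : 'S_l) :
  reflect (exists2 f : 'I_l -> 'I_n, increasing f &
             forall a b, (s (f a) < s (f b)) = (p a < p b))
          (contains s p).
Proof.
apply: (iffP existsP) => [[f /andP[/forallP fi /forallP fsp]]|[f fi fsp]].
  exists f => [a b|a b]; last by have /forallP/(_ b)/eqP := fsp a.
  by move/forallP: (fi a) => /(_ b)/implyP.
exists [ffun a => f a]; apply/andP; split; apply/forallP => a; apply/forallP => b.
  by apply/implyP => ab; rewrite !ffunE fi.
by rewrite !ffunE fsp.
Qed.

(** * 0-1 matrices, given by their sets of ones: the Marcus-Tardos bound *)

Definition mx_contains n m (A : {set 'I_n * 'I_n}) (p : 'S_m) : Prop :=
  exists f g : 'I_m -> 'I_n,
    [/\ increasing f, increasing g & forall a, (f a, g (p a)) \in A].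

Definition mx_transpose n (A : {set 'I_n * 'I_n}) : {set 'I_n * 'I_n} :=
  [set z | (z.2, z.1) \in A].

Lemma mx_contains_transpose n m (A : {set 'I_n * 'I_n}) (p : 'S_m) :
  mx_contains (mx_transpose A) p^-1%g -> mx_contains A p.
Proof.
move=> [f [g [fi gi fgA]]]; exists g, f; split=> // a.
by have := fgA (p a); rewrite inE permK.
Qed.

(** For monotone [phi] the fibers are intervals, and this is the matrix of nonzero blocks. *)
Definition contract N n (phi : 'I_N -> 'I_n) (A : {set 'I_N * 'I_N}) :
  {set 'I_n * 'I_n} := [set (phi z.1, phi z.2) | z in A].

(** Choose one cell of [A] in each block of the occurrence. Monotonicity of [phi] reflects strict
    inequalities, so the chosen cells are ordered like their blocks. *)
Lemma mx_contains_contract N n m (phi : 'I_N -> 'I_n) A (p : 'S_m) :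
  {homo phi : i j / i <= j} ->
  mx_contains (contract phi A) p -> mx_contains A p.
Proof.
move=> phi_homo [f [g [fi gi fgA]]].
have phi_lt i j : phi i < phi j -> i < j.
  by apply: contraTT; rewrite -!leqNgt; exact: phi_homo.
have /fin_all_exists[z zP] : forall a, exists z : 'I_N * 'I_N,
    [/\ z \in A, phi z.1 = f a & phi z.2 = g (p a)].
  by move=> a; have /imsetP[z zA [-> ->]] := fgA a; exists z.
exists (fun a => (z a).1), (fun b => (z (p^-1%g b)).2); split.
- move=> a b ab; apply: phi_lt.
  by have [_ -> _] := zP a; have [_ -> _] := zP b; exact: fi.
- move=> a b ab; apply: phi_lt.
  have [_ _ ->] := zP (p^-1%g a); have [_ _ ->] := zP (p^-1%g b).
  by rewrite !permKV; exact: gi.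
- by move=> a; rewrite permK -surjective_pairing; case: (zP a).
Qed.

Definition block_columns N n (phi : 'I_N -> 'I_n) (A : {set 'I_N * 'I_N})
    (x y : 'I_n) : {set 'I_N} :=
  [set j | (phi j == y) && [exists i, (phi i == x) && ((i, j) \in A)]].

(* If m of the blocks in one block column have ones in the same set of at least
   m columns, they contain every permutation matrix of size m. *)
Lemma card_wide_blocks N n m t (phi : 'I_N -> 'I_n) A (p : 'S_m) (y : 'I_n) :
  {homo phi : i j / i <= j} ->
  (forall x, #|[set i | phi i == x]| <= t) ->
  ~ mx_contains A p ->
  #|[set x | m <= #|block_columns phi A x y|]| <= m * 2 ^ t.
Proof.
move=> phi_homo fib avA; set X := [set x | _]; set W := block_columns phi A ^~ y.
set F := powerset [set i | phi i == y].
have WF x : x \in X -> W x \in F.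
  by move=> _; rewrite inE; apply/subsetP => j; rewrite !inE => /andP[].
(* Pigeonhole: the blocks are sorted by their set of nonzero columns, one of at most [2 ^ t] subsets
   of a fiber. *)
rewrite -sum1_card (partition_big W (mem F))//=.
have {WF}le_m S : S \in F -> \sum_(x in X | W x == S) 1 <= m.
  move=> SF; rewrite sum1dep_card leqNgt; apply/negP => mX.
  have [f fi fX] := ex_increasing (ltnW mX).
  have [x] : exists x, x \in [set x | (x \in X) && (W x == S)].
    by apply/set0Pn; rewrite -card_gt0; exact: leq_trans mX.
  rewrite !inE => /andP[mW /eqP WS]; move: mW; rewrite -/(W x) WS => mW.
  have [g gi gS] := ex_increasing mW.
  apply: avA; have /fin_all_exists[h hP] : forall a : 'I_m, exists i,
      phi i = f a /\ (i, g (p a)) \in A.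
    move=> a; have := fX a; rewrite !inE => /andP[_ /eqP Wfa].
    have := gS (p a); rewrite -Wfa inE => /andP[_ /existsP[i /andP[/eqP ? ?]]].
    by exists i.
  exists h, g; split=> // [a b ab|a]; last by case: (hP a).
  have := fi a b ab; have [<- _] := hP a; have [<- _] := hP b.
  by apply: contraTT; rewrite -!leqNgt; exact: phi_homo.
apply: (@leq_trans (\sum_(S in F) m)); first exact: leq_sum.
rewrite sum_nat_const card_powerset mulnC.
by rewrite leq_mul2l leq_exp2l// fib orbT.
Qed.

(** A block is wide if it has at least [m] nonzero columns, tall if it has at least [m] nonzero
    rows. If it is neither, its ones lie in a product of two sets of size below [m]; in every case
    it has at most [t ^ 2] cells. *)
Lemma card_block N n m t (phi : 'I_N -> 'I_n) (A : {set 'I_N * 'I_N}) z :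
  (forall x, #|[set i | phi i == x]| <= t) ->
  #|[set c in A | (phi c.1, phi c.2) == z]| <=
    m ^ 2 * (z \in contract phi A) +
    t ^ 2 * (m <= #|block_columns phi A z.1 z.2|) +
    t ^ 2 * (m <= #|block_columns phi (mx_transpose A) z.2 z.1|).
Proof.
move=> fib; set wide := m <= #|block_columns phi A _ _|; set tall := m <= _.
set B := [set c in A | _].
have leX (I J : {set 'I_N}) : B \subset setX I J -> #|B| <= #|I| * #|J|.
  by move=> /subset_leq_card; rewrite cardsX.
have Bt : #|B| <= t ^ 2.
  apply: (leq_trans (leX [set i | phi i == z.1] [set i | phi i == z.2] _)).
    by apply/subsetP => c; rewrite !inE => /andP[_ /eqP<-]; rewrite /= !eqxx.
  by rewrite -mulnn leq_mul.
case: (boolP wide) => [_|]; first by rewrite muln1; lia.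
rewrite -ltnNge => nwide.
case: (boolP tall) => [_|]; first by rewrite muln1; lia.
rewrite -ltnNge => ntall; rewrite !muln0 !addn0.
have [B0|[c cB]] := set_0Vmem B; first by rewrite B0 cards0.
have -> : z \in contract phi A.
  by move: cB; rewrite inE => /andP[cA /eqP<-]; apply/imsetP; exists c.
rewrite muln1 -mulnn.
apply: (leq_trans (leX (block_columns phi (mx_transpose A) z.2 z.1)
                       (block_columns phi A z.1 z.2) _)).
  apply/subsetP => -[i j]; rewrite !inE /= => /andP[ijA /eqP<-] /=; rewrite !eqxx/=.
  apply/andP; split; first by apply/existsP; exists j; rewrite inE eqxx.
  by apply/existsP; exists i; rewrite eqxx.
by rewrite leq_mul// ltnW.
Qed.

(** Sum [card_block] over all blocks. Each of the [n] block columns has at most [m * 2 ^ t] wide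
    blocks and, by transposition, each block row has at most that many tall ones. *)
Lemma card_contract N n m t (phi : 'I_N -> 'I_n) A (p : 'S_m) :
  {homo phi : i j / i <= j} ->
  (forall x, #|[set i | phi i == x]| <= t) ->
  ~ mx_contains A p ->
  #|A| <= m ^ 2 * #|contract phi A| + 2 * (t ^ 2 * (n * (m * 2 ^ t))).
Proof.
move=> phi_homo fib avA.
rewrite -sum1_card (partition_big (fun c => (phi c.1, phi c.2)) xpredT)//=.
under eq_bigr do rewrite sum1dep_card.
apply: leq_trans (leq_sum _ (fun z _ => card_block m A z fib)) _.
rewrite !big_split -!big_distrr /= -addnA mul2n -addnn.
have wideE (W : 'I_n -> {set 'I_n}) : (forall y, #|W y| <= m * 2 ^ t) ->
    \sum_(y < n) \sum_(x < n) (x \in W y) <= n * (m * 2 ^ t).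
  move=> hW; rewrite -[leqRHS](_ : \sum_(y < n) (m * 2 ^ t) = _).
    by apply: leq_sum => y _; rewrite -big_mkcond /= sum1_card.
  by rewrite sum_nat_const card_ord.
apply: leq_add; first by rewrite -big_mkcond /= sum1_card.
apply: leq_add; rewrite leq_mul2l; apply/orP; right.
  rewrite -(pair_bigA _ (fun x y => (m <= #|block_columns phi A x y|) : nat)) /=.
  rewrite exchange_big /=.
  apply: leq_trans (wideE (fun y => [set x | m <= #|block_columns phi A x y|]) _).
    by apply: leq_sum => y _; apply: leq_sum => x _; rewrite inE.
  by move=> y; exact: (card_wide_blocks _ _ _ avA).
rewrite -(pair_bigA _ (fun x y =>
  (m <= #|block_columns phi (mx_transpose A) y x|) : nat)) /=.
apply: leq_trans
  (wideE (fun y => [set x | m <= #|block_columns phi (mx_transpose A) x y|]) _).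
  by apply: leq_sum => y _; apply: leq_sum => x _; rewrite inE.
move=> y; apply: (@card_wide_blocks _ _ _ _ _ _ p^-1%g) => //.
by move=> /mx_contains_transpose.
Qed.

Definition div_ord t n : 'I_(t * n) -> 'I_n.
Proof.
move=> i; refine (@Ordinal n (i %/ t) _).
by have := ltn_ord i; case: t {i} (i : nat) => // t i; rewrite ltn_divLR// mulnC.
Defined.

Lemma div_ord_homo t n : {homo @div_ord t n : i j / i <= j}.
Proof. by move=> i j ij; by rewrite /= leq_div2r. Qed.

Lemma card_div_ord_fiber t n (x : 'I_n) : #|[set i | @div_ord t n i == x]| <= t.
Proof.
case: t => [|t]; first by rewrite (leq_trans (max_card _))// card_ord.
rewrite -[leqRHS]card_ord; set X := [set i | _].
have rlt (i : 'I_(t.+1 * n)) : i %% t.+1 < t.+1 by rewrite ltn_mod.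
apply: (@leq_card_in _ _ (fun i => Ordinal (rlt i)) (mem X)) => i j.
rewrite !inE => /eqP ix /eqP jx [ij]; apply: val_inj => /=.
rewrite (divn_eq i t.+1) (divn_eq j t.+1) ij.
by have /(congr1 val) /= -> : div_ord i = div_ord j by rewrite ix jx.
Qed.

Lemma marcus_tardos m (p : 'S_m) (t := m.+1 ^ 2) : exists c, forall r,
  forall A : {set 'I_(t ^ r) * 'I_(t ^ r)},
  ~ mx_contains A p -> #|A| <= c * t ^ r.
Proof.
(* With [s = t ^ r] and the constant written [D.+1], contraction leaves at most
   [m ^ 2 * (D.+1 * s) + D * s] ones, which is at most [D.+1 * (t * s)] because [m ^ 2 < t]. *)
exists (2 * (t ^ 2 * (m * 2 ^ t))).+1; elim=> [|r IHr] A avA.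
  by rewrite (leq_trans (max_card _))// card_prod card_ord.
rewrite expnS in A avA *.
have phi_homo := @div_ord_homo t (t ^ r).
apply: leq_trans (card_contract phi_homo (@card_div_ord_fiber t _) avA) _.
have /IHr : ~ mx_contains (contract (@div_ord t (t ^ r)) A) p.
  by move=> /(mx_contains_contract phi_homo).
move: #|contract _ _| => b.
clear; move: (t ^ r) => s bs.
have m2t : m ^ 2 < t by rewrite ltn_sqr.
move: bs; set D := 2 * _ => bs.
have -> : 2 * (t ^ 2 * (s * (m * 2 ^ t))) = D * s by rewrite /D; lia.
apply: (@leq_trans (m ^ 2 * (D.+1 * s) + D * s)).
  by rewrite leq_add2r leq_mul2l bs orbT.
apply: (@leq_trans ((m ^ 2).+1 * (D.+1 * s))).
  by rewrite [leqRHS]mulSn addnC leq_add2r leq_mul2r leqnSn orbT.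
by rewrite mulnCA leq_mul2l leq_mul2r m2t !orbT.
Qed.

(** * Exponential bounds for avoiding matrices and permutations *)

Definition avoiding_mx n m (p : 'S_m) : {set {set 'I_n * 'I_n}} :=
  [set A : {set 'I_n * 'I_n} | `[< ~ mx_contains A p >]].

(** A matrix with contraction [B] is a subset of the union of the blocks in [B], which has at most
    [t ^ 2 * b] cells. *)
Lemma card_avoiding_mx_contract N n m t b (phi : 'I_N -> 'I_n) (p : 'S_m) :
  {homo phi : i j / i <= j} ->
  (forall x, #|[set i | phi i == x]| <= t) ->
  (forall B : {set 'I_n * 'I_n}, ~ mx_contains B p -> #|B| <= b) ->
  #|avoiding_mx N p| <= #|avoiding_mx n p| * 2 ^ (t ^ 2 * b).
Proof.
move=> phi_homo fib hb.
rewrite -sum1_card (partition_big (contract phi) (mem (avoiding_mx n p)))/=; last first.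
  move=> A; rewrite !inE => /asboolP avA; apply/asboolP.
  by move=> /(mx_contains_contract phi_homo).
rewrite -sum_nat_const; apply: leq_sum => B; rewrite inE => /asboolP/hb Bb.
rewrite sum1dep_card; set phi2 := fun c : 'I_N * 'I_N => (phi c.1, phi c.2).
apply: (@leq_trans #|powerset (phi2 @^-1: B)|).
  apply/subset_leq_card/subsetP => A; rewrite !inE => /andP[_ /eqP<-].
  by apply/subsetP => c cA; rewrite inE; apply/imsetP; exists c.
rewrite card_powerset leq_exp2l//.
rewrite -sum1_card (partition_big phi2 (mem B))/=; last by move=> c; rewrite inE.
apply: (@leq_trans (\sum_(z in B) t ^ 2)); last first.
  by rewrite sum_nat_const mulnC leq_mul2l Bb orbT.
apply: leq_sum => z _; rewrite sum1dep_card.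
apply: (@leq_trans #|setX [set i | phi i == z.1] [set i | phi i == z.2]|).
  apply/subset_leq_card/subsetP => c; rewrite !inE => /andP[_ /eqP<-].
  by rewrite /= !eqxx.
by rewrite cardsX -mulnn leq_mul.
Qed.

Lemma card_avoiding_mx_exp_bound m (p : 'S_m) (t := m.+1 ^ 2) : 0 < m ->
  exists E, forall r, #|avoiding_mx (t ^ r) p| <= 2 ^ (E * t ^ r).
Proof.
move=> m0; have [c hc] := marcus_tardos p.
have t2 : 2 <= t by rewrite /t; nia.
(* Going from size [t ^ r] to [t ^ r.+1] adds [t ^ 2 * c * t ^ r] to the exponent. This at most
   doubles the bound [E * t ^ r], and [2 <= t]. *)
exists (t ^ 2 * c).+1; elim=> [|r IHr].
  rewrite (leq_trans (max_card _))// -cardsT -powersetT card_powerset cardsT.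
  by rewrite card_prod card_ord leq_exp2l// muln1.
rewrite expnS; apply: leq_trans (card_avoiding_mx_contract
  (@div_ord_homo t (t ^ r)) (@card_div_ord_fiber t _) (hc r)) _.
apply: leq_trans (leq_mul IHr (leqnn _)) _.
rewrite -expnD leq_exp2l// mulnA -mulnDl mulnA leq_mul2r; apply/orP; right.
by nia.
Qed.

Lemma contains_graph n N m (nN : n <= N) (s : 'S_n) (q : 'S_m) :
  mx_contains [set (widen_ord nN i, widen_ord nN (s i)) | i : 'I_n] q ->
  contains s q.
Proof.
move=> [f [g [fi gi fgA]]].
have /fin_all_exists[h hP] : forall a, exists i : 'I_n,
    f a = i :> nat /\ g (q a) = s i :> nat.
  by move=> a; have /imsetP[i _ [-> ->]] := fgA a; exists i.
apply/existsP; exists [ffun a => h a]; apply/andP; split.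
  apply/forallP => a; apply/forallP => b; apply/implyP => ab; rewrite !ffunE.
  by have [<- _] := hP a; have [<- _] := hP b; exact: fi.
apply/forallP => a; apply/forallP => b; rewrite !ffunE.
by have [_ <-] := hP a; have [_ <-] := hP b; rewrite increasing_ltn.
Qed.

(** Graphs inject avoiding permutations into avoiding matrices. The side is the first power of [t]
    above [n]; it is at most [t * n], which explains the base [2 ^ (E * t)]. *)
Lemma num_avoiding_exp_bound m (q : 'S_m) : 0 < m ->
  exists C, forall n, num_avoiding q n <= C ^ n.
Proof.
move=> m0; have [E hE] := card_avoiding_mx_exp_bound q m0; set t := m.+1 ^ 2 in hE.
have t1 : 1 < t by rewrite /t; nia.
exists (2 ^ (E * t)) => n.
have [->|n0] := posnP n.
  by rewrite expn0 (leq_trans (max_card _))// card_Sn.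
have /andP[lo hi] := trunc_log_bounds t1 n0.
set r := (trunc_log t n).+1 in hi.
apply: (@leq_trans #|avoiding_mx (t ^ r) q|).
  pose G (s : 'S_n) : {set 'I_(t ^ r) * 'I_(t ^ r)} :=
    [set (widen_ord (ltnW hi) i, widen_ord (ltnW hi) (s i)) | i : 'I_n].
  have Ginj : injective G.
    move=> s s' ss'; apply/permP => i.
    have : (widen_ord (ltnW hi) i, widen_ord (ltnW hi) (s i)) \in G s'.
      by rewrite -ss'; apply/imsetP; exists i.
    move=> /imsetP[j _ [ij sij]]; apply: val_inj => /=.
    by rewrite sij (_ : i = j)//; apply: val_inj.
  rewrite /num_avoiding -(card_imset _ Ginj); apply/subset_leq_card/subsetP => A.
  move=> /imsetP[s]; rewrite !inE => avs ->; apply/asboolP => /contains_graph.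
  exact/negP.
apply: leq_trans (hE r) _; rewrite -expnM leq_exp2l// -mulnA leq_mul2l.
by rewrite /r expnS leq_mul2l lo !orbT.
Qed.

(** * Direct sums, reversal and supermultiplicativity *)

Definition dsum_fun a b (s : 'S_a) (t : 'S_b) (i : 'I_(a + b)) : 'I_(a + b) :=
  match split i with inl x => lshift b (s x) | inr y => rshift a (t y) end.

Lemma dsum_fun_inj a b (s : 'S_a) (t : 'S_b) : injective (dsum_fun s t).
Proof.
move=> i j; rewrite -[i]splitK -[j]splitK /dsum_fun !unsplitK.
case: (split i) => x; case: (split j) => y /= /eqP.
- by rewrite eq_lshift => /eqP/perm_inj->.
- by rewrite eq_lrshift.
- by rewrite eq_rlshift.
- by rewrite eq_rshift => /eqP/perm_inj->.
Qed.

Definition dsum a b (s : 'S_a) (t : 'S_b) : 'S_(a + b) :=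
  perm (@dsum_fun_inj a b s t).

Lemma dsum_lshift a b (s : 'S_a) (t : 'S_b) x : dsum s t (lshift b x) = lshift b (s x).
Proof. by rewrite permE /dsum_fun (unsplitK (inl x)). Qed.

Lemma dsum_rshift a b (s : 'S_a) (t : 'S_b) y : dsum s t (rshift a y) = rshift a (t y).
Proof. by rewrite permE /dsum_fun (unsplitK (inr y)). Qed.

Lemma dsum_inj a b (s s' : 'S_a) (t t' : 'S_b) :
  dsum s t = dsum s' t' -> s = s' /\ t = t'.
Proof.
move=> eq_d; split; apply/permP => x.
  by apply: (@lshift_inj _ b); rewrite -(dsum_lshift s t) eq_d dsum_lshift.
by apply: (@rshift_inj a b); rewrite -(dsum_rshift s t) eq_d dsum_rshift.
Qed.

Lemma ltn_dsum a b (s : 'S_a) (t : 'S_b) i : (dsum s t i < a) = (i < a).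
Proof.
case: (split_ordP i) => j ->; rewrite ?dsum_lshift ?dsum_rshift /=.
  by rewrite !ltn_ord.
by rewrite !ltnNge !leq_addr.
Qed.

(* If an occurrence of the maximum of q lies in the first summand, then all
   smaller values do; otherwise the minimum, which comes later, lies in the
   second summand, and then all larger values do. *)
Lemma contains_dsum a b m (s : 'S_a) (t : 'S_b) (q : 'S_m) (x y : 'I_m) :
  x < y -> (forall z, q z <= q x) -> (forall z, q y <= q z) ->
  contains (dsum s t) q -> contains s q || contains t q.
Proof.
move=> xy qx qy /containsP[f fi fq].
have le_f i j : q i <= q j -> dsum s t (f i) <= dsum s t (f j).
  by rewrite leqNgt -fq -leqNgt.
have [fxa|afx] := ltnP (f x) a.
  apply/orP; left; apply/containsP.
  have /fin_all_exists[g gP] : forall z, exists i, f z = lshift b i.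
    move=> z; have : f z < a.
      by rewrite -(ltn_dsum s t) (leq_ltn_trans (le_f _ _ (qx z)))// ltn_dsum.
    by case: (split_ordP (f z)) => j -> /=; [exists j|lia].
  exists g => [i j /fi|i j]; first by rewrite !gP.
  by rewrite -fq !gP !dsum_lshift.
apply/orP; right; apply/containsP.
have /fin_all_exists[g gP] : forall z, exists i, f z = rshift a i.
  move=> z; have : a <= f z.
    rewrite leqNgt -(ltn_dsum s t) -leqNgt (leq_trans _ (le_f _ _ (qy z)))//.
    by rewrite leqNgt ltn_dsum -leqNgt (leq_trans afx)// ltnW// fi.
  case: (split_ordP (f z)) => j -> /=; last by exists j.
  by have := ltn_ord j; lia.
exists g => [i j /fi|i j]; first by rewrite !gP /= ltn_add2l.
by rewrite -fq !gP !dsum_rshift /= ltn_add2l.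
Qed.

Definition reverse n (s : 'S_n) : 'S_n := (perm (@rev_ord_inj n) * s)%g.

Lemma reverseE n (s : 'S_n) i : reverse s i = s (rev_ord i).
Proof. by rewrite permM permE. Qed.

Lemma reverseK n : involutive (@reverse n).
Proof. by move=> s; apply/permP => i; rewrite !reverseE rev_ordK. Qed.

Lemma contains_reverse n l (s : 'S_n) (q : 'S_l) :
  contains s q -> contains (reverse s) (reverse q).
Proof.
move=> /containsP[f fi fq]; apply/containsP.
exists (fun i => rev_ord (f (rev_ord i))) => [i j ij|i j].
  have : f (rev_ord j) < f (rev_ord i) by apply: fi => /=; have := ltn_ord j; lia.
  by move=> /=; have := ltn_ord (f (rev_ord i)); lia.
by rewrite !reverseE !rev_ordK fq.
Qed.

Lemma num_avoiding_reverse l (q : 'S_l) n :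
  num_avoiding (reverse q) n = num_avoiding q n.
Proof.
have le (r : 'S_l) : num_avoiding r n <= num_avoiding (reverse r) n.
  rewrite /num_avoiding -(card_imset _ (inv_inj (@reverseK n))).
  apply/subset_leq_card/subsetP => s /imsetP[u]; rewrite !inE => avu ->.
  by apply: contra avu => /contains_reverse; rewrite !reverseK.
by apply/eqP; rewrite eqn_leq le -{2}(reverseK q) le.
Qed.

(* Direct sums work if the maximum of q precedes its minimum; reversal reduces
   the other case to this one. *)
Lemma num_avoiding_supermul m (q : 'S_m) a b : 1 < m ->
  num_avoiding q a * num_avoiding q b <= num_avoiding q (a + b).
Proof.
have max_min (r : 'S_m) (x y : 'I_m) : x < y -> (forall z, r z <= r x) ->
    (forall z, r y <= r z) ->
    num_avoiding r a * num_avoiding r b <= num_avoiding r (a + b).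
  move=> xy rx ry; rewrite /num_avoiding -cardsX.
  have dinj : injective (fun st : 'S_a * 'S_b => dsum st.1 st.2).
    by move=> [s t] [s' t'] /= /dsum_inj[-> ->].
  rewrite -(card_imset _ dinj); apply/subset_leq_card/subsetP => u.
  move=> /imsetP[[s t]]; rewrite !inE /= => /andP[avs avt] ->.
  apply/negP => /(contains_dsum xy rx ry).
  by rewrite (negbTE avs) (negbTE avt).
case: m q max_min => // m q max_min m1.
(* The positions of the maximum and of the minimum of [q]; they differ since [1 < m]. *)
pose x := q^-1%g ord_max; pose y := q^-1%g ord0.
have qx z : q z <= q x by rewrite permKV -ltnS.
have qy z : q y <= q z by rewrite permKV.
have [xy|yx|/val_inj/perm_inj/(congr1 val) /= m0] := ssrnat.ltngtP x y.
- exact: (max_min q x y).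
- rewrite -!(num_avoiding_reverse q).
  apply: (max_min (reverse q) (rev_ord x) (rev_ord y)) => /=.
  + by have := ltn_ord x; lia.
  + by move=> z; rewrite !reverseE rev_ordK.
  + by move=> z; rewrite !reverseE rev_ordK.
- by rewrite m0 in m1.
Qed.

(** Permutations shorter than [q] avoid it, and supermultiplicativity with a summand of length 1
    carries positivity on. This makes the logarithms below nonnegative. *)
Lemma num_avoiding_gt0 m (q : 'S_m) n : 1 < m -> 0 < num_avoiding q n.
Proof.
move=> m1; have small j : j < m -> 0 < num_avoiding q j.
  move=> jm; rewrite card_gt0; apply/set0Pn; exists 1%g; rewrite inE.
  apply/containsP => -[f fi _].
  by have := leq_card f (increasing_inj fi); rewrite !card_ord leqNgt jm.
elim: n => [|n IHn]; first by rewrite small// ltnW.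
rewrite -(addn1 n); apply: leq_trans (num_avoiding_supermul q n 1 m1).
by rewrite muln_gt0 IHn small.
Qed.

Lemma num_avoiding_size1 (q : 'S_1) n : 0 < n -> num_avoiding q n = 0.
Proof.
case: n => // n _; apply/eqP; rewrite cards_eq0; apply/eqP/setP => s.
rewrite !inE; apply/negbTE; rewrite negbK; apply/containsP.
by exists (fun=> ord0) => a b; rewrite !ord1 ?ltnn.
Qed.

(** * Padding by holes and the lower bound *)

Lemma increasing_gap m n (f : 'I_m -> 'I_n) (a b : 'I_m) :
  increasing f -> a <= b -> f a + (b - a) <= f b.
Proof.
move=> fi ab; have [d] : exists d, d = b - a :> nat by exists (b - a).
elim: d b ab => [|d IHd] b ab dE.
  by rewrite -dE addn0; have -> : a = b by apply: val_inj => /=; lia.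
have cm : b.-1 < m by have := ltn_ord b; lia.
have /IHd : a <= Ordinal cm by rewrite /=; lia.
have : f (Ordinal cm) < f b by apply: fi => /=; lia.
by rewrite /=; lia.
Qed.

Lemma partial_perm_position n k (w : {ffun 'I_n -> option 'I_(n - k)}) :
  is_partial_perm w ->
  exists P : 'I_(n - k) -> 'I_n, forall i v, (w i == Some v) = (i == P v).
Proof.
move=> /andP[/forallP wP _].
have /fin_all_exists[P PP] : forall v, exists i, [set i | w i == Some v] = [set i].
  by move=> v; apply/cards1P.
by exists P => i v; move/setP: (PP v) => /(_ i); rewrite !inE.
Qed.

Lemma position_inj n k (w : {ffun 'I_n -> option 'I_(n - k)})
    (P : 'I_(n - k) -> 'I_n) :
  (forall i v, (w i == Some v) = (i == P v)) -> injective P.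
Proof.
move=> PP v1 v2 P12; have : w (P v1) == Some v1 by rewrite PP.
by rewrite P12; have := PP (P v2) v2; rewrite eqxx => /eqP-> /eqP[].
Qed.

(** [insub] fails from position [i + (n - k)] on, so for [i <= k <= n] there are [i] holes before
    [s] and [k - i] after it. *)
Definition pad n k i (s : 'S_(n - k)) : {ffun 'I_n -> option 'I_(n - k)} :=
  [ffun x : 'I_n => if i <= x then omap s (insub (x - i)) else None].

Lemma padP n k i (s : 'S_(n - k)) (x : 'I_n) v : i <= k ->
  (pad i s x == Some v) = (i <= x) && (x == i + s^-1%g v :> nat).
Proof.
move=> ik; rewrite ffunE; case: ifP => //= ix.
case: insubP => [u _ uE|] /=.
  rewrite -[Some _ == _]/(s u == v) -(inj_eq (@perm_inj _ s^-1%g)) permK.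
  by rewrite -val_eqE /= uE; apply/eqP/eqP; lia.
move=> /negP xi; apply/esym/eqP => xE; apply: xi.
by rewrite xE; have := ltn_ord (s^-1%g v); lia.
Qed.

Lemma pad_partial_perm n k i (s : 'S_(n - k)) : i <= k -> k <= n ->
  is_partial_perm (pad i s).
Proof.
move=> ik kn; have sh (j : 'I_(n - k)) : i + j < n by have := ltn_ord j; lia.
have shP x v : (pad i s x == Some v) = (x == Ordinal (sh (s^-1%g v))).
  by rewrite padP// -val_eqE /=; apply/andP/eqP => [[_ /eqP]//|->]; rewrite leq_addr.
apply/andP; split.
  apply/forallP => v; apply/cards1P; exists (Ordinal (sh (s^-1%g v))).
  by apply/setP => x; rewrite !inE shP.
set D := [set x | _].
have -> : D = ~: [set Ordinal (sh j) | j : 'I_(n - k)].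
  apply/setP => x; rewrite !inE; case: eqP => [wx|].
    apply/esym/negP => /imsetP[j _ xj]; have := shP x (s j).
    by rewrite wx permK xj eqxx.
  case E : (pad i s x) => [v|] // _; apply/esym/negbTE; rewrite negbK.
  apply/imsetP; exists (s^-1%g v) => //; apply/eqP.
  by rewrite -shP E.
rewrite cardsCs setCK card_imset ?card_ord; first by apply/eqP; lia.
by move=> a b /(congr1 val) /= /addnI/val_inj.
Qed.

Lemma num_partial_avoiding_lower k l (p : 'S_l) (q : 'S_(l - k)) n :
  k < l -> k <= n -> consecutive_subpattern q p ->
  num_avoiding q (n - k) <= num_partial_avoiding p k n.
Proof.
move=> kl kn [i [fp [fpE fpq]]].
have ik : i <= k.
  have lt : (l - k).-1 < l - k by lia.
  by have := ltn_ord (fp (Ordinal lt)); rewrite fpE /=; lia.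
have pinj : injective (@pad n k i).
  move=> s t st; apply: (can_inj invgK); apply/permP => v.
  have sh : i + s^-1%g v < n by have := ltn_ord (s^-1%g v); lia.
  have : pad i s (Ordinal sh) == Some v by rewrite padP// eqxx leq_addr.
  rewrite st padP// => /andP[_ /eqP/addnI]; exact: val_inj.
rewrite /num_avoiding -(card_imset _ pinj); apply/subset_leq_card/subsetP => w.
move=> /imsetP[s]; rewrite !inE => avs ->; rewrite pad_partial_perm//=.
apply/forallP => u; apply/implyP => /forallP ext.
apply: contra avs => /containsP[F Fi Fp]; apply/containsP.
(* In [p] there are [i] entries before the copy of [q] and [k - i] after it. By [increasing_gap],
   [F] maps this copy between positions [i] and [i + (n - k) - 1], where there are no holes. *)
have /fin_all_exists[G GP] : forall x, exists y : 'I_(n - k), F (fp x) = i + y :> nat.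
  move=> x; have l0 : 0 < l by lia.
  have l1 : l.-1 < l by lia.
  have := @increasing_gap _ _ F (Ordinal l0) (fp x) Fi isT.
  have := @increasing_gap _ _ F (fp x) (Ordinal l1) Fi.
  have := ltn_ord (F (Ordinal l1)); rewrite /= fpE; have := ltn_ord x => xl Fl H1 H2.
  have lt : F (fp x) - i < n - k by lia.
  by exists (Ordinal lt) => /=; lia.
have padG x : pad i s (F (fp x)) == Some (s (G x)).
  by rewrite padP// permK GP eqxx leq_addr.
have stdG x : standardization (nonholes (pad i s)) u (F (fp x)) = s (G x).
  by have /forallP/(_ (s (G x)))/implyP/(_ (padG x))/eqP := ext (F (fp x)).
exists G => [x y xy|x y].
  by rewrite -(ltn_add2l i) -!GP; apply: Fi; rewrite !fpE ltn_add2l.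
(* A standardization is a rank, so on non-holes it compares entries as [u] does. *)
rewrite -!stdG (@ltn_rank _ _ (fun i => u i)) ?Fp ?fpq//.
by rewrite inE (eqP (padG x)).
Qed.

(** * Filling holes, encoding by blocks and the upper bound *)

Definition holes_before n k (w : {ffun 'I_n -> option 'I_(n - k)}) (i : 'I_n) : nat :=
  rank [set i | w i == None] val i.

(* The j-th block of w consists of the entries preceded by exactly j holes. An
   occurrence in it of the entries of p at positions j, ..., j + m - 1 is
   completed to an occurrence of p in an extension: the a-th hole plays the
   role of entry a of p if a < j and of entry a + m otherwise. *)
Lemma block_occurrence_extends n k m l (w : {ffun 'I_n -> option 'I_(n - k)})
    (p : 'S_l) (j : nat) (sub : 'I_m -> 'I_l) (F0 : 'I_m -> 'I_n)
    (V : 'I_m -> 'I_(n - k)) :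
  l = m + k -> 0 < m -> j <= k -> is_partial_perm w ->
  (forall x, sub x = j + x :> nat) -> increasing F0 ->
  (forall x, w (F0 x) = Some (V x)) -> (forall x, holes_before w (F0 x) = j) ->
  (forall x y, (V x < V y) = (p (sub x) < p (sub y))) ->
  ~~ partial_avoids w p.
Proof.
move=> lE m0 jk wpp subE F0i wF0 hbF0 Vp.
have [P PP] := partial_perm_position wpp.
set D := [set i | w i == None].
have cardD : #|D| = k by have /andP[_ /eqP] := wpp.
have rkD i : i \in D -> rank D val i < k by rewrite -cardD; exact: rank_ltn_card.
pose shift r := if r < j then r else r + m.
have /fin_all_exists[hp hpE] : forall i, exists a : 'I_l,
    i \in D -> a = shift (rank D val i) :> nat.
  move=> i; have [/rkD rk|_] := boolP (i \in D).
    have lt : shift (rank D val i) < l by rewrite /shift; case: ifP => _; lia.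
    by exists (Ordinal lt).
  by have lt : 0 < l by [lia]; exists (Ordinal lt).
pose top (a : 'I_l) := \max_(x : 'I_m | p (sub x) < p a) (V x).+1.
(* A hole is placed just above the largest selected value below its role. *)
pose u i := if w i is Some v then l.+1 * v.+1
            else l.+1 * top (hp i) + (p (hp i)).+1.
(* Modulo [l.+1], the key of a value is 0 and that of a hole is [(p _).+1], between 1 and [l]. Hence
   keys are distinct, and holes with the same [top] are ordered by their roles in [p]. *)
have key_mod a b (x y : 'I_l) : l.+1 * a + x.+1 = l.+1 * b + y.+1 -> x = y.
  move=> /(congr1 (modn^~ l.+1)); rewrite ![l.+1 * _]mulnC !modnMDl !modn_small ?ltnS//.
  by move=> [/val_inj].
have key_neq a b (x : 'I_l) : l.+1 * a + x.+1 <> l.+1 * b.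
  move=> /(congr1 (modn^~ l.+1)).
  by rewrite ![l.+1 * _]mulnC modnMDl modnMl modn_small ?ltnS.
have uinj : injective u.
  move=> i i'; rewrite /u; case wi : (w i) => [v|]; case wi' : (w i') => [v'|].
  - move=> /eqP; rewrite eqn_mul2l /= => /eqP[/val_inj vv'].
    by apply/eqP; rewrite -[i'](eqP (_ : P v == i')) -?PP ?wi ?vv'// eq_sym -PP wi'.
  - by move=> /esym/key_neq.
  - by move=> /key_neq.
  - have iD : i \in D by rewrite inE wi.
    have iD' : i' \in D by rewrite inE wi'.
    move=> /key_mod/perm_inj/(congr1 val); rewrite /= !hpE// => sh.
    have : rank D val i = rank D val i' by move: sh; rewrite /shift; do 2 case: ifP; lia.
    by apply: rank_inj => // ? ? _ _; exact: val_inj.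
apply/forallPn; exists (std u); rewrite negb_imply negbK; apply/andP; split.
  apply/forallP => i; apply/forallP => v; apply/implyP => wi.
  have -> : standardization (nonholes w) (std u) i =
      #|P @: [set v' : 'I_(n - k) | v' < v]|.
    apply: eq_card => i'; rewrite !inE ltn_std//; apply/andP/imsetP.
      rewrite /u (eqP wi); case E : (w i') => [v'|]; last by [case].
      rewrite ltn_mul2l /= ltnS => -[_ v'v]; exists v'; first by rewrite inE.
      by apply/eqP; rewrite -PP E.
    move=> [v']; rewrite inE => v'v /eqP; rewrite -PP => /eqP wi'.
    by rewrite /u wi' (eqP wi) ltn_mul2l /= ltnS.
  rewrite (card_imset _ (position_inj PP)).
  rewrite -sum1dep_card (eq_bigl (fun v' : 'I_(n - k) => v' < v)) //.
  rewrite -(big_ord_widen _ (fun=> 1) (ltnW (ltn_ord v))).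
  by rewrite sum1_card card_ord.
(* Each entry of [p] is played by a selected value or by the hole with that role. *)
have /fin_all_exists[F FP] : forall a : 'I_l, exists i,
    (exists2 x, a = sub x & i = F0 x) \/ (i \in D /\ hp i = a).
  move=> a.
  have hole r : r < k -> shift r = a -> exists i,
    (exists2 x, a = sub x & i = F0 x) \/ (i \in D /\ hp i = a).
    move=> rk ra; have [||i iD ir] := @rank_surj _ D val r; rewrite ?cardD//.
      by move=> ? ? _ _; exact: val_inj.
    by exists i; right; split=> //; apply: val_inj; rewrite /= hpE// ir.
  have [aj|ja] := ltnP a j; first by apply: (hole a); rewrite /shift ?aj; lia.
  have [am|ma] := ltnP a (j + m).
    have lt : a - j < m by lia.
    exists (F0 (Ordinal lt)); left; exists (Ordinal lt) => //.
    by apply: val_inj; rewrite /= subE /=; lia.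
  apply: (hole (a - m)); rewrite /shift; first by have := ltn_ord a; lia.
  by case: ifP; lia.
have hb x : rank D val (F0 x) = j by rewrite -(hbF0 x).
apply/containsP; exists F => [a b ab|].
  have [[x ax Fx]|[aD ha]] := FP a; have [[y by_ Fy]|[bD hb_]] := FP b.
  - by rewrite Fx Fy; apply: F0i; move: ab; rewrite ax by_ !subE ltn_add2l.
  (* The hole [F b] has at least [j] holes before it and [F0 x] has exactly [j], so the hole does
     not come first; it is not at [F0 x], where there is a value. *)
  - have Fab : F a != F b.
      by apply/eqP => Fab; move: bD; rewrite inE -Fab Fx wF0.
    rewrite ltn_neqAle Fab leqNgt -(@ltn_rank _ D val)// Fx hb /=.
    have := hpE _ bD; rewrite hb_ /shift; move: ab; rewrite ax subE.
    by have := ltn_ord x; case: ifP; lia.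
  - rewrite -(@ltn_rank _ D val)// Fy hb.
    have := hpE _ aD; rewrite ha /shift; move: ab; rewrite by_ subE.
    by have := ltn_ord y; case: ifP; lia.
  - rewrite -(@ltn_rank _ D val)//; move: ab.
    have := hpE _ aD; have := hpE _ bD; rewrite ha hb_ /shift.
    by do 2 case: ifP; lia.
suff mono a b : p a < p b -> u (F a) < u (F b).
  move=> a b; rewrite ltn_std//; have [/mono//|] := ltnP (p a) (p b).
  rewrite leq_eqVlt => /predU1P[/val_inj/perm_inj->|/mono]; rewrite ?ltnn//.
  by move=> ba; apply/negbTE; rewrite -leqNgt ltnW.
have uF0 x : u (F0 x) = l.+1 * (V x).+1 by rewrite /u wF0.
have uD i : i \in D -> u i = l.+1 * top (hp i) + (p (hp i)).+1.
  by rewrite inE /u => /eqP->.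
move=> pab.
have [[x ax Fx]|[aD ha]] := FP a; have [[y by_ Fy]|[bD hb_]] := FP b.
- by rewrite Fx Fy !uF0 ltn_mul2l /= ltnS Vp -ax -by_.
- rewrite Fx uF0 uD// hb_ addnS ltnS (leq_trans _ (leq_addr _ _))// leq_mul2l /=.
  by apply: (leq_bigmax_cond x); rewrite -ax.
(* Selected values whose role is below [p a] are below [V y], so [top a] is at most [V y], and the
   remainder [(p a).+1] is less than [l.+1]. *)
- rewrite Fy uF0 uD// ha mulnS addnC -addSn; apply: leq_add.
    by have := ltn_ord (p a).
  rewrite leq_mul2l /=; apply/bigmax_leqP => x xa.
  by rewrite Vp (ltn_trans xa)// -by_.
- rewrite !uD// ha hb_ -addnS leq_add// leq_mul2l /=.
  apply/bigmax_leqP => x xa; apply: (leq_bigmax_cond x).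
  exact: ltn_trans pab.
Qed.

Lemma holes_before_leq n k (w : {ffun 'I_n -> option 'I_(n - k)}) i :
  is_partial_perm w -> holes_before w i <= k.
Proof.
move=> /andP[_ /eqP cardD]; rewrite -[leqRHS]cardD; apply/subset_leq_card/subsetP => j.
by rewrite !inE => /andP[].
Qed.

Lemma ltn_holes_before n k (w : {ffun 'I_n -> option 'I_(n - k)}) i j :
  holes_before w i < holes_before w j -> i < j.
Proof.
apply: contraTT; rewrite -!leqNgt => ji; apply/subset_leq_card/subsetP => x.
by rewrite !inE => /andP[->] /= /leq_trans; exact.
Qed.

(** Each position before [P v] holds either a value or a hole. *)
Lemma position_decomposition n k (w : {ffun 'I_n -> option 'I_(n - k)})
    (P : 'I_(n - k) -> 'I_n) v :
  (forall i v, (w i == Some v) = (i == P v)) ->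
  P v = #|[set v' | P v' < P v]| + holes_before w (P v) :> nat.
Proof.
move=> PP; have Pinj := position_inj PP.
rewrite -(card_imset _ Pinj) /holes_before /rank.
set A := [set _ | _ in _]; set B := [set _ in _ | _].
have -> : #|A| + #|B| = #|A :|: B|.
  rewrite cardsU (_ : A :&: B = set0) ?cards0 ?subn0//; apply/setP => i.
  rewrite !inE; apply/negP => /andP[/imsetP[v' _ ->]].
  by have := PP (P v') v'; rewrite eqxx => /eqP->.
rewrite (_ : A :|: B = [set i : 'I_n | i < P v]).
  rewrite -sum1dep_card -(big_ord_widen _ (fun=> 1) (ltnW (ltn_ord (P v)))).
  by rewrite sum1_card card_ord.
apply/setP => i; rewrite !inE; case E : (w i) => [v'|].
  have /eqP iE : i == P v' by rewrite -PP E.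
  rewrite iE /= orbF; apply/imsetP/idP => [[v1]|lt].
    by rewrite inE => lt /Pinj->.
  by exists v'; rewrite ?inE.
rewrite eqxx /=; apply/orb_idl => /imsetP[v' _ iE].
by have := PP i v'; rewrite E iE eqxx.
Qed.

(* A word w is encoded by the block c v of each value v together with, for each
   j, the permutation formed by block j. The position of v is recovered as the
   number of values placed before v plus the number c v of holes before it. *)
Lemma num_partial_avoiding_upper k l (p : 'S_l) (qs : 'I_k.+1 -> 'S_(l - k))
    (sub : 'I_k.+1 -> 'I_(l - k) -> 'I_l) n :
  k < l ->
  (forall j x, sub j x = j + x :> nat) ->
  (forall j x y, (p (sub j x) < p (sub j y)) = (qs j x < qs j y)) ->
  num_partial_avoiding p k n <=
    \sum_(c : {ffun 'I_(n - k) -> 'I_k.+1})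
      \prod_(j < k.+1) num_avoiding (qs j) #|[set v | c v == j]|.
Proof.
move=> kl subE subP; rewrite /num_partial_avoiding.
pose word := {ffun 'I_n -> option 'I_(n - k)}.
(* For a partial permutation these maxima run over a single position; as maxima they are defined for
   every word. *)
pose pos (w : word) v : nat := \max_(i | w i == Some v) i.
pose block (w : word) v : nat := \max_(i | w i == Some v) holes_before w i.
pose blocks (w : word) : {ffun 'I_(n - k) -> 'I_k.+1} :=
  [ffun v => inord (block w v)].
rewrite -sum1_card (partition_big blocks xpredT)//=.
apply: leq_sum => c _; rewrite sum1dep_card; set X := [set w | _].
pose V j := [set v | c v == j].
have /fin_all_exists[e eP] : forall j, exists e : 'I_#|V j| -> 'I_(n - k),
    increasing e /\ forall a, e a \in V j.
  by move=> j; have [e ? ?] := ex_increasing (leqnn #|V j|); exists e.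
have einj j : injective (e j) by exact: increasing_inj (eP j).1.
have esurj j v : c v = j -> exists a, v = e j a.
  move=> cv; have eV : codom (e j) \subset V j.
    by apply/subsetP => x /codomP[a ->]; exact: (eP j).2.
  have /subset_cardP/(_ eV)/(_ v) : #|codom (e j)| = #|V j|.
    by rewrite (card_codom (einj j)) card_ord.
  by rewrite [in RHS]inE cv eqxx => /codomP.
have wX w : w \in X -> exists P : 'I_(n - k) -> 'I_n,
    [/\ forall i v, (w i == Some v) = (i == P v), forall v, pos w v = P v,
        injective P & forall v, c v = holes_before w (P v) :> nat].
  rewrite inE => /andP[]; rewrite inE => /andP[wpp _] /eqP cw.
  have [P PP] := partial_perm_position wpp; exists P; split=> // [v||v].
  - by rewrite /pos (eq_bigl (pred1 (P v))) ?big_pred1_eq// => i; rewrite PP.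
  - exact: position_inj PP.
  rewrite -cw ffunE /block (eq_bigl (pred1 (P v))) ?big_pred1_eq => [|i].
    by rewrite inordK// ltnS holes_before_leq.
  by rewrite PP.
(* The standardized positions send values to places inside the block; the inverse is the block read
   as a permutation. *)
pose Phi w : {dffun forall j, 'S_#|V j|} :=
  finfun (fun j => (std (fun a => pos w (e j a)))^-1%g).
have pos_inj w j : w \in X -> injective (fun a => pos w (e j a)).
  by move=> /wX[P [_ posE Pinj _]] a b; rewrite !posE => /val_inj/Pinj/einj.
have Phi_inj : {in X &, injective Phi}.
  move=> w w' wX1 wX2 Phi_ww'; have [P [PP posP Pinj cP]] := wX w wX1.
  have [P' [PP' posP' P'inj cP']] := wX w' wX2.
  (* Values in different blocks are placed in the order of the blocks; values in one block are
     compared by its permutation. The order of the positions then determines the positions. *)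
  have lt_P v1 v2 : (P v1 < P v2) = (P' v1 < P' v2).
    have [lt|lt|/val_inj c12] := ssrnat.ltngtP (c v1) (c v2).
    - have -> : P v1 < P v2 by apply: (@ltn_holes_before _ _ w); rewrite -!cP.
      by apply/esym/(@ltn_holes_before _ _ w'); rewrite -!cP'.
    - have /ltnW : P v2 < P v1 by apply: (@ltn_holes_before _ _ w); rewrite -!cP.
      have /ltnW : P' v2 < P' v1 by apply: (@ltn_holes_before _ _ w'); rewrite -!cP'.
      by rewrite leqNgt => /negbTE->; rewrite leqNgt => /negbTE->.
    - have [a ->] := esurj _ v1 c12; have [b v2E] := esurj _ v2 erefl.
      rewrite [in P v2]v2E [in P' v2]v2E.
      rewrite -!posP -!posP'.
      rewrite -(ltn_std a b (pos_inj w _ wX1)) -(ltn_std a b (pos_inj w' _ wX2)).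
      have := congr1 (fun f : {dffun forall j, 'S_#|V j|} => f (c v2)) Phi_ww'.
      by rewrite /Phi !ffunE => /invg_inj->.
  have PE v : P v = P' v.
    apply: val_inj => /=.
    rewrite (position_decomposition v PP) (position_decomposition v PP') -cP -cP'.
    by congr (_ + _); apply: eq_card => v'; rewrite !inE lt_P.
  apply/ffunP => i; case E : (w i) => [v|].
    by apply/esym/eqP; rewrite PP' -PE -PP E.
  case E' : (w' i) => [v|] //.
  by move: (PP i v); rewrite E PE -PP' E' eqxx.
rewrite -(card_in_imset Phi_inj).
pose A j : pred 'S_#|V j| := [pred s | ~~ contains s (qs j)].
have <- : #|(family A : simpl_pred {dffun forall j : 'I_k.+1, 'S_#|V j|})| =
    \prod_(j < k.+1) num_avoiding (qs j) #|V j|.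
  rewrite card_family foldrE big_map big_enum /=.
  by apply: eq_bigr => j _; apply: eq_card => s; rewrite inE.
apply/subset_leq_card/subsetP => f /imsetP[w wX1 ->]; apply/familyP => j.
rewrite /Phi ffunE inE; apply/negP => /containsP[g gi gq].
have [P [PP posP Pinj cP]] := wX w wX1.
have := wX1; rewrite !inE => /andP[/andP[wpp wav] _].
set s := (std _)^-1%g in gq.
move: wav; apply/negP.
(* Place [g x] of block [j] holds the value [e j (s (g x))]. *)
apply: (@block_occurrence_extends _ _ (l - k) _ _ _ j (sub j)
  (fun x => P (e j (s (g x)))) (fun x => e j (s (g x)))) => //.
- by lia.
- by lia.
- by rewrite -ltnS.
- move=> x y xy; rewrite -!posP -(ltn_std _ _ (pos_inj w j wX1)).
  by rewrite -[std _]invgK -/s !permK gi.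
- by move=> x; apply/eqP; rewrite PP.
- by move=> x; rewrite -cP; have := (eP j).2 (s (g x)); rewrite inE => /eqP->.
- by move=> x y; rewrite (increasing_ltn _ _ (eP j).1) gq subP.
Qed.

Lemma sum_card_fibers N k (c : {ffun 'I_N -> 'I_k}) :
  \sum_(j < k) #|[set v | c v == j]| = N.
Proof.
rewrite -[RHS]card_ord -sum1_card (partition_big c xpredT)//=.
by apply: eq_bigr => j _; rewrite sum1dep_card.
Qed.

End Combinatorics.

(** * Fekete's lemma and the Stanley-Wilf limit *)

Section Asymptotics.
Local Open Scope classical_set_scope.
Local Open Scope ring_scope.
Set Implicit Arguments.
Unset Strict Implicit.

(** The limit is the supremum of [a n / n] over positive [n]. If [m.+1] nearly attains it and
    [n = q * m.+1 + r], then [a n] is at least [q * a m.+1]. *)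
Lemma fekete (R : realType) (a : nat -> R) (c : R) :
  (forall m n, a m + a n <= a (m + n)%N) -> (forall n, 0 <= a n) ->
  (forall n, a n <= c * n%:R) ->
  exists L : R, (forall n, a n <= L * n%:R) /\ (fun n => a n / n%:R) @ \oo --> L.
Proof.
move=> aD a0 ac; pose E := [set a n.+1 / n.+1%:R | n in setT].
have Esup : has_sup E.
  split; first by exists (a 1%N / 1%:R); exists 0%N.
  by exists c => _ [n _ <-]; rewrite ler_pdivrMr.
have aL n : a n <= sup E * n%:R.
  case: n => [|n]; first by have := ac 0%N; rewrite !mulr0.
  by rewrite -ler_pdivrMr//; apply: sup_upper_bound => //; exists n.
have aM q m : q%:R * a m <= a (q * m)%N.
  elim: q => [|q IHq]; first by rewrite mul0r.
  rewrite mulSn -natr1 mulrDl mul1r addrC; apply: le_trans (aD _ _).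
  by rewrite lerD2l.
exists (sup E); split=> //; apply/cvgrPdist_le => e e0.
have [_ [m _ <-] mE] : exists2 x, E x & sup E - e / 2 < x.
  by apply: sup_adherent => //; rewrite divr_gt0.
have L0 : 0 <= sup E.
  have := aL 1%N; rewrite mulr1; exact: le_trans.
near=> n.
have n0 : 0 < n%:R :> R by near: n; exact: nbhs_infty_gtr.
rewrite ger0_norm ?subr_ge0 ?ler_pdivrMr//.
rewrite lerBlDr -lerBlDl ler_pdivlMr//.
(* This keeps the loss due to the remainder [r] below [e / 2 * n]. *)
have nL : m.+1%:R * sup E / (e / 2) <= n%:R by near: n; exact: nbhs_infty_ger.
rewrite ler_pdivrMr ?divr_gt0// in nL.
rewrite ltr_pdivlMr// in mE.
pose q := (n %/ m.+1)%N; pose r := (n %% m.+1)%N.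
have nE : n%:R = q%:R * m.+1%:R + r%:R :> R by rewrite -natrM -natrD -divn_eq.
have rm : r%:R <= m.+1%:R :> R by rewrite ler_nat ltnW// ltn_mod.
have aq : q%:R * a m.+1 <= a n.
  apply: le_trans (aM q m.+1) _; have := aD (q * m.+1)%N r; rewrite -divn_eq.
  by apply: le_trans; rewrite lerDl.
(* If [sup E - e / 2] is negative, the required lower bound for [a n] is nonpositive; otherwise
   inequalities may be multiplied by it. *)
have [L2|L2] := leP 0 (sup E - e / 2); last first.
  by apply: le_trans (a0 n); rewrite mulr_le0_ge0 ?ler0n//; lra.
have q0 : 0 <= q%:R :> R by [].
apply: le_trans aq.
have qm := ler_wpM2l q0 (ltW mE).
have rL := ler_wpM2l L2 rm.
have := mulr_ge0 (ltW (divr_gt0 e0 (ltr0Sn R 1))) (ler0n R m.+1).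
by rewrite nE in nL *; nra.
Unshelve. all: by end_near.
Qed.

(** [fekete] applies to the logarithms: supermultiplicativity gives superadditivity, and the
    exponential bound a linear one. Continuity of [expR] identifies [K] with [expR L]. *)
Lemma stanley_wilf_gt1 (R : realType) m (q : 'S_m) (K := stanley_wilf_limit R q) :
  (1 < m)%N ->
  [/\ 1 <= K, forall n, (num_avoiding q n)%:R <= K ^+ n &
      (fun n => ln (num_avoiding q n)%:R / n%:R : R) @ \oo --> ln K].
Proof.
move=> m1; have s1 n : 1 <= (num_avoiding q n)%:R :> R.
  by rewrite ler1n num_avoiding_gt0.
have s0 n : 0 < (num_avoiding q n)%:R :> R by exact: lt_le_trans (s1 n).
have [C sC] := num_avoiding_exp_bound q (ltnW m1).
have C0 : 0 < C%:R :> R.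
  rewrite ltr0n lt0n; apply/eqP => C0; have := sC 1%N.
  by rewrite C0 leqNgt num_avoiding_gt0.
have [L [aL aE]] : exists L : R,
    (forall n, ln (num_avoiding q n)%:R <= L * n%:R) /\
    (fun n => ln (num_avoiding q n)%:R / n%:R) @ \oo --> L.
  apply: (@fekete R (fun n => ln (num_avoiding q n)%:R) (ln C%:R)) => [a b|n|n].
  - rewrite -lnM ?posrE// ler_ln ?posrE ?mulr_gt0// -natrM ler_nat.
    exact: num_avoiding_supermul.
  - exact: ln_ge0.
  - rewrite mulr_natr -lnXn// ler_ln ?posrE ?exprn_gt0// -natrX ler_nat.
    exact: sC.
have KE : K = expR L.
  apply/cvg_lim => //.
  rewrite (_ : (fun n => _) = expR \o (fun n => ln (num_avoiding q n)%:R / n%:R)).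
    by apply: continuous_cvg aE; exact: continuous_expR.
  by apply/funext => n /=; rewrite /powR gt_eqF// mulrC.
rewrite KE expRK; split=> // [|n].
  rewrite -expR0 ler_expR; have := aL 1%N; rewrite mulr1.
  by apply: le_trans; exact: ln_ge0.
by rewrite -expRM_natr -ler_ln ?posrE ?expR_gt0// expRK.
Qed.

(** Only the empty permutation avoids the pattern of length 1. The length is a variable so that the
    lemma applies to [l - k]. *)
Lemma stanley_wilf_eq1 (R : realType) m (q : 'S_m) :
  m = 1%N -> stanley_wilf_limit R q = 0.
Proof.
move=> m1; rewrite {}m1 in q *.
apply/cvg_lim => //; apply: cvg_near_cst; near=> n.
have n0 : (0 < n)%N by near: n; exact: nbhs_infty_gt.
by rewrite num_avoiding_size1// powR0// invr_neq0// pnatr_eq0 -lt0n.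
Unshelve. all: by end_near.
Qed.

Lemma num_avoiding_le_limit (R : realType) m (q : 'S_m) n : (0 < m)%N ->
  (num_avoiding q n)%:R <= stanley_wilf_limit R q ^+ n.
Proof.
case: m q => // -[|m] q _; last by case: (stanley_wilf_gt1 R q isT).
rewrite stanley_wilf_eq1//; case: n => [|n]; last first.
  by rewrite num_avoiding_size1// expr0n.
by rewrite expr0 lern1 (leq_trans (max_card _))// card_Sn.
Qed.

Lemma stanley_wilf_ge0 (R : realType) m (q : 'S_m) : (0 < m)%N ->
  0 <= stanley_wilf_limit R q.
Proof.
case: m q => // -[|m] q _; first by rewrite stanley_wilf_eq1.
by have [K1 _ _] := stanley_wilf_gt1 R q isT; exact: le_trans K1.
Qed.

(** There are [k.+1 ^ (n - k)] distributions [c]. For each, the block sizes add up to [n - k], so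
    bounding every limit by [K] bounds the product by [K ^+ (n - k)]. *)
Lemma num_partial_avoiding_le (R : realType) k l (p : 'S_l) (q : 'S_(l - k)) n
    (K := stanley_wilf_limit R q) :
  (k < l)%N ->
  (forall q' : 'S_(l - k), consecutive_subpattern q' p ->
     stanley_wilf_limit R q' <= K) ->
  (num_partial_avoiding p k n)%:R <= (k.+1%:R * K) ^+ (n - k) :> R.
Proof.
move=> kl Kmax; have m0 : (0 < l - k)%N by rewrite subn_gt0.
have lt (j : 'I_k.+1) (x : 'I_(l - k)) : (j + x < l)%N.
  by have := ltn_ord j; have := ltn_ord x; lia.
pose sub j x := Ordinal (lt j x).
pose qs j : 'S_(l - k) := std (fun x => p (sub j x)).
have qsE j x y : (p (sub j x) < p (sub j y))%N = (qs j x < qs j y)%N.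
  by rewrite ltn_std// => u v /val_inj/perm_inj/(congr1 val)/addnI/val_inj.
have qsK j : stanley_wilf_limit R (qs j) <= K.
  by apply: Kmax; exists j, (sub j); split=> // x y; rewrite qsE.
have subE j x : sub j x = (j + x)%N :> nat by [].
have := num_partial_avoiding_upper n kl subE qsE.
rewrite -(ler_nat R) natr_sum => /le_trans; apply.
have cardc : #|{ffun 'I_(n - k) -> 'I_k.+1}| = (k.+1 ^ (n - k))%N.
  by rewrite card_ffun !card_ord.
rewrite exprMn -natrX -cardc mulr_natl -sumr_const; apply: ler_sum => c _.
have -> : K ^+ (n - k) = \prod_(j < k.+1) K ^+ #|[set v | c v == j]%SET|.
  by rewrite prodrXr sum_card_fibers.
rewrite natr_prod.
apply: ler_prod => j _; rewrite ler0n /=.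
apply: le_trans (num_avoiding_le_limit R _ _ m0) _.
by rewrite lerXn2r ?nnegrE ?stanley_wilf_ge0//
  (le_trans _ (qsK j))// stanley_wilf_ge0.
Qed.

End Asymptotics.

(** * The asymptotic bounds *)

Local Open Scope classical_set_scope.
Local Open Scope ring_scope.

Theorem theorem36 (R : realType) (k l : nat) (p : 'S_l) (q : 'S_(l - k)) :
  (k < l)%N ->
  consecutive_subpattern q p ->
  (forall q' : 'S_(l - k), consecutive_subpattern q' p ->
     stanley_wilf_limit R q' <= stanley_wilf_limit R q) ->
  exists e1 e2 : nat -> R,
    [/\ e1 =o_\oo (fun n : nat => n%:R : R),
        e2 =o_\oo (fun n : nat => n%:R : R) &
        \forall n \near \oo,
          stanley_wilf_limit R q `^ (n%:R + e1 n)
            <= (num_partial_avoiding p k n)%:R :> R /\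
          (num_partial_avoiding p k n)%:R
            <= k.+1%:R ^+ n * stanley_wilf_limit R q `^ (n%:R + e2 n) :> R].
Proof.
move=> kl qp Kmax; set K := stanley_wilf_limit R q in Kmax *.
have m0 : (0 < l - k)%N by rewrite subn_gt0.
have K0 : 0 <= K by exact: stanley_wilf_ge0.
have upper : \forall n \near \oo,
    (num_partial_avoiding p k n)%:R <= k.+1%:R ^+ n * K `^ (n%:R + 0) :> R.
  near=> n.
  have kn : (k < n)%N by near: n; exact: nbhs_infty_gt.
  rewrite addr0 powR_mulrn// -exprMn.
  apply: (@le_trans _ _ ((k.+1%:R * K) ^+ (n - k))).
    exact: num_partial_avoiding_le.
  (* The exponent [n - k] may be raised to [n] if [1 <= K]; otherwise [K = 0] and the left side
     vanishes as [k < n]. *)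
  have [l2|l1] := ltnP 1 (l - k).
    have [K1 _ _] := stanley_wilf_gt1 R q l2.
    by rewrite ler_weXn2l ?leq_subr// mulr_ege1// ler1n.
  have -> : K = 0 by apply: stanley_wilf_eq1; lia.
  rewrite mulr0 !expr0n (_ : (n - k == 0)%N = false) ?ler0n//; lia.
have lower : \forall n \near \oo,
    (num_avoiding q (n - k))%:R <= (num_partial_avoiding p k n)%:R :> R.
  near=> n; rewrite ler_nat num_partial_avoiding_lower//.
  by near: n; exact: nbhs_infty_ge.
have zero_o : (fun=> 0 : R) =o_\oo (fun n : nat => n%:R : R).
  by apply/eqoP => e e0; near=> n; rewrite normr0 mulr_ge0// ltW.
(* In this case [K] is 1 or 0, and so is the lower bound for large [n]; dividing by [ln K] is
   impossible. *)
have [K1|K1] := leP K 1.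
  exists (fun=> 0), (fun=> 0); split=> //.
  near=> n; split; last by near: n.
  apply: (@le_trans _ _ (num_avoiding q (n - k))%:R); last by near: n.
  have [l2|l1] := ltnP 1 (l - k).
    have [K1' _ _] := stanley_wilf_gt1 R q l2.
    have -> : K = 1 by apply/eqP; rewrite eq_le K1.
    by rewrite powR1 ler1n num_avoiding_gt0.
  have n0 : (0 < n)%N by near: n; exact: nbhs_infty_gt.
  have -> : K = 0 by apply: stanley_wilf_eq1; lia.
  by rewrite powR0// addr0 pnatr_eq0 -lt0n.
have l2 : (1 < l - k)%N.
  rewrite ltnNge; apply/negP => l1; move: K1.
  by rewrite /K stanley_wilf_eq1 ?ltr10//; lia.
have [_ _ /cvgrPdist_lt cvgK] := stanley_wilf_gt1 R q l2.
have lnK0 : 0 < ln K by rewrite ln_gt0.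
(* This choice makes the power [n + e1 n] of [K] equal to [num_avoiding q (n - k)]. *)
pose e1 n : R := ln (num_avoiding q (n - k))%:R / ln K - n%:R.
exists e1, (fun=> 0); split=> //.
  apply/eqoP => e e0.
  have /cvgK[N _ NK] : 0 < e / 2 * ln K by rewrite mulr_gt0// divr_gt0.
  near=> n.
  have kn : (k < n)%N by near: n; exact: nbhs_infty_gt.
  have Nn : (N + k <= n)%N by near: n; exact: nbhs_infty_ge.
  have ken : k%:R / (e / 2) <= n%:R :> R by near: n; exact: nbhs_infty_ger.
  have /= := NK (n - k)%N; rewrite leq_subRL ?(ltnW kn)// addnC => /(_ Nn).
  rewrite ler_pdivrMr ?divr_gt0// in ken.
  have j0 : 0 < (n - k)%:R :> R by rewrite ltr0n subn_gt0.
  have nE : n%:R = (n - k)%:R + k%:R :> R by rewrite -natrD subnK// ltnW.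
  rewrite /e1 [`|n%:R|]ger0_norm//; set s := ln _%:R => sK.
  (* One half of [e] covers the convergence at [n - k], the other the shift by [k]. *)
  have {}sK : `|s / ln K - (n - k)%:R| < e / 2 * (n - k)%:R.
    move: sK; rewrite -/K; set j := (n - k)%:R in j0 *.
    have -> : s / ln K - j = (s / j - ln K) * (j / ln K).
      by field; rewrite !gt_eqF.
    have -> : e / 2 * j = e / 2 * ln K * (j / ln K) by field; rewrite gt_eqF.
    by rewrite normrM distrC [`|j / _|]gtr0_norm ?divr_gt0// ltr_pM2r ?divr_gt0.
  have -> : s / ln K - n%:R = (s / ln K - (n - k)%:R) - k%:R by rewrite nE; lra.
  apply: le_trans (ler_normB _ _) _; rewrite normr_nat.
  have nkn : (n - k)%:R <= n%:R :> R by rewrite ler_nat leq_subr.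
  by nra.
near=> n; split; last by near: n.
apply: (@le_trans _ _ (num_avoiding q (n - k))%:R); last by near: n.
rewrite /e1 addrC subrK /powR gt_eqF ?(lt_trans ltr01)// divfK ?gt_eqF//.
by rewrite lnK ?posrE ?ltr0n ?num_avoiding_gt0.
Unshelve. all: by end_near.
Qed.
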